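(* Let $(W,T)$ be a dual Coxeter system of finite rank $m$ and let $c = s_1\cdots s_n$ be a parabolic Coxeter element in $W$, where $S=\{s_1,\ldots,s_m\}$ is a simple system for $(W,T)$ and $n\le m$. Then the Hurwitz action of the braid group $B_n$ on $\mathrm{Red}_T(c)$ is transitive. In symbols, for each $(t_1,\ldots,t_n)\in T^n$ such that $c=t_1\cdots t_n$, there is a braid group element $b\in B_n$ such that $$b(t_1,\ldots,t_n)=(s_1,\ldots,s_n).$$
   Context: A dual Coxeter system of finite rank $m$ is a pair $(W,T)$, where $W$ is a group and $T\subseteq W$, such that there is a subset $S\subseteq T$ with $|S|=m$ for which $(W,S)$ is a Coxeter system and $T=\{wsw^{-1}: w\in W,\ s\in S\}$ is the set of reflections of $(W,S)$. Any such $S$ is called a simple system for $(W,T)$; different simple systems need not be conjugate in $W$. An element $c\in W$ is called a parabolic Coxeter element for $(W,T)$ if there is a simple system $S=\{s_1,\ldots,s_m\}$ for $(W,T)$ (listed in some order, the elements being pairwise distinct) such that $c=s_1\cdots s_n$ for some $n\le m$. For $w\in W$, $\ell_T(w)$ denotes the minimal $k$ such that $w$ is a product of $k$ elements of $T$, and $\mathrm{Red}_T(w)$ denotes the set of reduced factorizations of $w$ into reflections, i.e. the set of tuples $(t_1,\ldots,t_k)\in T^k$ with $k=\ell_T(w)$ and $t_1\cdots t_k=w$. The braid group $B_n$ on $n$ strands has generators $\sigma_1,\ldots,\sigma_{n-1}$ and relations $\sigma_i\sigma_j=\sigma_j\sigma_i$ for $|i-j|>1$ and $\sigma_i\sigma_{i+1}\sigma_i=\sigma_{i+1}\sigma_i\sigma_{i+1}$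 (it is trivial for $n\le 1$). It acts on $T^n$ by $$\sigma_i(t_1,\ldots,t_n)=(t_1,\ldots,t_{i-1},\,t_it_{i+1}t_i,\,t_i,\,t_{i+2},\ldots,t_n),$$ $$\sigma_i^{-1}(t_1,\ldots,t_n)=(t_1,\ldots,t_{i-1},\,t_{i+1},\,t_{i+1}t_it_{i+1},\,t_{i+2},\ldots,t_n).$$ The induced action on $\mathrm{Red}_T(w)$ (with $n=\ell_T(w)$) is called the Hurwitz action. One has $\ell_T(c)=n$ for $c=s_1\cdots s_n$ as in the statement. *)

(* Defs.v *)
From HB Require Import structures.
From mathcomp Require Import all_boot.
From mathcomp Require Import boolp classical_sets.

Set Implicit Arguments.
Unset Strict Implicit.
Unset Printing Implicit Defensive.

Local Open Scope group_scope.
Local Open Scope classical_set_scope.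
Local Open Scope quotient_scope.

(* Group presentations.  A letter (i, true) stands for the generator i and
   (i, false) for its inverse; a word [:: l_1; ...; l_k] stands for the product
   l_1 * ... * l_k, and R u v for the relation u = v. *)
Section Presentation.
Variables (I : choiceType) (R : seq (I * bool) -> seq (I * bool) -> Prop).

Local Notation word := (seq (I * bool)).

Inductive word_eq : word -> word -> Prop :=
| word_eq_refl u : word_eq u u
| word_eq_sym u v : word_eq u v -> word_eq v u
| word_eq_trans v u w : word_eq u v -> word_eq v w -> word_eq u w
| word_eq_cat u u' v v' :
    word_eq u u' -> word_eq v v' -> word_eq (u ++ v) (u' ++ v')
| word_eq_cancel i b : word_eq [:: (i, b); (i, ~~ b)] [::]
| word_eq_rel u v : R u v -> word_eq u v.

Definition word_eqb (u v : word) : bool := `[< word_eq u v >].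

Lemma word_eqb_refl : reflexive word_eqb.
Proof. by move=> u; apply/asboolP; exact: word_eq_refl. Qed.

Lemma word_eqb_sym : symmetric word_eqb.
Proof. by move=> u v; apply/asboolP/asboolP; exact: word_eq_sym. Qed.

Lemma word_eqb_trans : transitive word_eqb.
Proof.
move=> v u w /asboolP uv /asboolP vw; apply/asboolP.
exact: word_eq_trans vw.
Qed.

Canonical word_equiv :=
  EquivRel word_eqb word_eqb_refl word_eqb_sym word_eqb_trans.

Definition presented_group : Type := {eq_quot word_equiv}.
HB.instance Definition _ := Choice.on presented_group.
HB.instance Definition _ := EqQuotient.on presented_group.

Definition pg_class (u : word) : presented_group := \pi u.

Lemma pg_classP u v : pg_class u = pg_class v <-> word_eq u v.
Proof.
split; first by move/eqmodP/asboolP.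
by move=> uv; apply/eqmodP/asboolP.
Qed.

Lemma pg_classK (x : presented_group) : pg_class (repr x) = x.
Proof. exact: reprK. Qed.

Lemma pg_class_ind (P : presented_group -> Prop) :
  (forall u, P (pg_class u)) -> forall x, P x.
Proof. by move=> Pcl x; rewrite -[x]pg_classK. Qed.

Definition word_inv (u : word) : word := rev [seq (l.1, ~~ l.2) | l <- u].

Definition pg_mul (x y : presented_group) := pg_class (repr x ++ repr y).
Definition pg_inv (x : presented_group) := pg_class (word_inv (repr x)).

Lemma word_eq_repr u : word_eq (repr (pg_class u)) u.
Proof. by apply/pg_classP; rewrite pg_classK. Qed.

Lemma word_eq_inv u v : word_eq u v -> word_eq (word_inv u) (word_inv v).
Proof.
have invr w : word_eq (w ++ word_inv w) [::].
  elim: w => [|[i b] w IH]; first exact: word_eq_refl.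
  rewrite /word_inv /= rev_cons -cats1 catA.
  apply: word_eq_trans (word_eq_cancel i b).
  have h := @word_eq_cat [:: (i, b)] _ _ _ (word_eq_refl _) IH.
  exact: (word_eq_cat h (word_eq_refl [:: (i, ~~ b)])).
have invl w : word_eq (word_inv w ++ w) [::].
  have wK : word_inv (word_inv w) = w.
    rewrite /word_inv map_rev revK -map_comp map_id_in // => -[i b] _ /=.
    by rewrite negbK.
  by rewrite -{2}wK.
move=> uv; apply: (word_eq_trans (v := word_inv u ++ (v ++ word_inv v))).
  rewrite -[X in word_eq X _]cats0.
  by apply: word_eq_cat (word_eq_refl _) (word_eq_sym _).
rewrite catA -[X in word_eq _ X]cat0s.
apply: word_eq_cat (word_eq_refl _).
apply: word_eq_trans (invl u).
by apply: word_eq_cat (word_eq_refl _) (word_eq_sym _).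
Qed.

Lemma pg_mulE u v : pg_mul (pg_class u) (pg_class v) = pg_class (u ++ v).
Proof. by apply/pg_classP/word_eq_cat; apply: word_eq_repr. Qed.

Lemma pg_invE u : pg_inv (pg_class u) = pg_class (word_inv u).
Proof. by apply/pg_classP/word_eq_inv/word_eq_repr. Qed.

Lemma pg_mulA : associative pg_mul.
Proof.
elim/pg_class_ind=> u; elim/pg_class_ind=> v; elim/pg_class_ind=> w.
by rewrite !pg_mulE catA.
Qed.

Lemma pg_mul1 : left_id (pg_class [::]) pg_mul.
Proof. by elim/pg_class_ind=> u; rewrite pg_mulE. Qed.

Lemma pg_mulr1 : right_id (pg_class [::]) pg_mul.
Proof. by elim/pg_class_ind=> u; rewrite pg_mulE cats0. Qed.

Lemma pg_mulrV : right_inverse (pg_class [::]) pg_inv pg_mul.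
Proof.
elim/pg_class_ind=> u; rewrite pg_invE.
elim: u => [|[i b] u IH]; first by rewrite pg_mulE.
rewrite -cat1s -pg_mulE /word_inv cat1s map_cons rev_cons -cats1 -pg_mulE.
rewrite pg_mulA -(pg_mulA (pg_class [:: (i, b)])) IH pg_mulr1 pg_mulE.
by apply/pg_classP; apply: word_eq_cancel.
Qed.

Lemma pg_mulV : left_inverse (pg_class [::]) pg_inv pg_mul.
Proof.
move=> x; rewrite -{2}[x]pg_mulr1 -(pg_mulrV (pg_inv x)) (pg_mulA x).
by rewrite pg_mulrV pg_mul1 pg_mulrV.
Qed.

HB.instance Definition _ :=
  isGroup.Build presented_group pg_mulA pg_mul1 pg_mulr1 pg_mulV pg_mulrV.

Definition pg_gen (i : I) : presented_group := pg_class [:: (i, true)].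

End Presentation.

(* M i j = None encodes m_ij = oo. *)
Definition coxeter_matrix (m : nat) (M : 'I_m -> 'I_m -> option nat) : Prop :=
  [/\ forall i, M i i = Some 1%N,
      forall i j, M i j = M j i
    & forall i j k, i != j -> M i j = Some k -> (2 <= k)%N].

Inductive coxeter_rel (m : nat) (M : 'I_m -> 'I_m -> option nat) :
    seq ('I_m * bool) -> seq ('I_m * bool) -> Prop :=
| CoxeterRel i j k : M i j = Some k ->
    coxeter_rel M (flatten (nseq k [:: (i, true); (j, true)])) [::].

Definition coxeter_group (m : nat) (M : 'I_m -> 'I_m -> option nat) : groupType :=
  presented_group (coxeter_rel M).

Section DualCoxeter.
Variable W : groupType.

(* The finite set S is given by a listing s of its elements. *)
Definition coxeter_system (m : nat) (s : m.-tuple W) : Prop :=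
  uniq s /\
  exists M : 'I_m -> 'I_m -> option nat, coxeter_matrix M /\
    exists phi : {multiplicative coxeter_group M -> W},
      bijective phi /\ forall i, phi (pg_gen (coxeter_rel M) i) = tnth s i.

Definition reflections (m : nat) (s : m.-tuple W) : set W :=
  [set t | exists w x, x \in s /\ t = w * x * w^-1].

Definition simple_system (T : set W) (m : nat) (s : m.-tuple W) : Prop :=
  coxeter_system s /\ T = reflections s.

Definition dual_coxeter_system (T : set W) (m : nat) : Prop :=
  exists s : m.-tuple W, simple_system T s.

Definition factorization (T : set W) (w : W) (k : nat) (t : k.-tuple W) : Prop :=
  (forall i, T (tnth t i)) /\ \prod_(x <- t) x = w.

(* The value is 0 by convention if w is not a product of elements of T. *)
Definition refl_length (T : set W) (w : W) : nat :=
  if pselect (exists k, `[< exists t : k.-tuple W, factorization T w t >])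
    is left ex_fact then ex_minn ex_fact else 0%N.

Definition Red (T : set W) (w : W) : set ((refl_length T w).-tuple W) :=
  [set t | factorization T w t].

End DualCoxeter.

Arguments Red {W} T w.

(* i : 'I_n.-1 stands for sigma_(i+1). *)
Inductive braid_rel (n : nat) :
    seq ('I_n.-1 * bool) -> seq ('I_n.-1 * bool) -> Prop :=
| BraidComm (i j : 'I_n.-1) : (i.+1 < j)%N || (j.+1 < i)%N ->
    braid_rel [:: (i, true); (j, true)] [:: (j, true); (i, true)]
| BraidBraid (i j : 'I_n.-1) : j = i.+1 :> nat ->
    braid_rel [:: (i, true); (j, true); (i, true)]
              [:: (j, true); (i, true); (j, true)].

Definition braid_group (n : nat) : groupType := presented_group (@braid_rel n).

Section Hurwitz.
Variables (W : groupType) (n : nat).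

Definition hurwitz_sigma (i : 'I_n.-1) (t : n.-tuple W) : n.-tuple W :=
  let ti := nth 1 t i in let ti1 := nth 1 t i.+1 in
  [tuple if j == i :> nat then ti * ti1 * ti
         else if j == i.+1 :> nat then ti
         else tnth t j | j < n].

Definition hurwitz_sigmaV (i : 'I_n.-1) (t : n.-tuple W) : n.-tuple W :=
  let ti := nth 1 t i in let ti1 := nth 1 t i.+1 in
  [tuple if j == i :> nat then ti1
         else if j == i.+1 :> nat then ti1 * ti * ti1
         else tnth t j | j < n].

Definition hurwitz_word (u : seq ('I_n.-1 * bool)) (t : n.-tuple W) :
    n.-tuple W :=
  foldr (fun l => if l.2 then hurwitz_sigma l.1 else hurwitz_sigmaV l.1) t u.

(* This is an action only on tuples of involutions, such as those in T^n; there
   the choice of the representative is irrelevant, see hurwitz_class below. *)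
Definition hurwitz (b : braid_group n) (t : n.-tuple W) : n.-tuple W :=
  hurwitz_word (repr (b : presented_group (@braid_rel n))) t.

Definition involutive_tuple (t : n.-tuple W) : Prop :=
  forall j, nth 1 t j * nth 1 t j = 1.

Lemma nth_sigma i t j : nth 1 (hurwitz_sigma i t) j =
  if j == i :> nat then nth 1 t i * nth 1 t i.+1 * nth 1 t i
  else if j == i.+1 then nth 1 t i else nth 1 t j.
Proof.
have ltiS : i.+1 < n by case: (n) i => [|k] [].
case: (ltnP j n) => [ltj|lej].
  by rewrite -(tnth_nth 1 _ (Ordinal ltj)) tnth_mktuple /= (tnth_nth 1).
have [ij iSj] : (i < j)%N /\ (i.+1 < j)%N.
  by split; apply: leq_trans lej; rewrite // ltnW.
by rewrite !gtn_eqF // !nth_default ?size_tuple.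
Qed.

Lemma nth_sigmaV i t j : nth 1 (hurwitz_sigmaV i t) j =
  if j == i :> nat then nth 1 t i.+1
  else if j == i.+1 then nth 1 t i.+1 * nth 1 t i * nth 1 t i.+1
  else nth 1 t j.
Proof.
have ltiS : i.+1 < n by case: (n) i => [|k] [].
case: (ltnP j n) => [ltj|lej].
  by rewrite -(tnth_nth 1 _ (Ordinal ltj)) tnth_mktuple /= (tnth_nth 1).
have [ij iSj] : (i < j)%N /\ (i.+1 < j)%N.
  by split; apply: leq_trans lej; rewrite // ltnW.
by rewrite !gtn_eqF // !nth_default ?size_tuple.
Qed.

Lemma hurwitz_word_inv u t :
  involutive_tuple t -> involutive_tuple (hurwitz_word u t).
Proof.
have inv3 (x y : W) : x * x = 1 -> y * y = 1 -> (x * y * x) * (x * y * x) = 1.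
  by move=> xx yy; rewrite !mulgA -(mulgA _ x x) xx mulg1 -(mulgA _ y y) yy mulg1.
move=> tI; elim: u => [|[i []] u IH] //= j; rewrite ?nth_sigma ?nth_sigmaV.
  by case: ifP => // _; [exact: inv3 | case: ifP].
by case: ifP => // _; case: ifP => // _; exact: inv3.
Qed.

Lemma hurwitz_word_eq u v t : word_eq (@braid_rel n) u v ->
  involutive_tuple t -> hurwitz_word u t = hurwitz_word v t.
Proof.
move=> uv; elim: uv t => {u v}.
- by [].
- by move=> u v _ IH t tI; rewrite IH.
- by move=> v u w _ IHu _ IHv t tI; rewrite IHu // IHv.
- move=> u u' v v' _ IHu _ IHv t tI; rewrite /hurwitz_word !foldr_cat.
  by rewrite -!/(hurwitz_word _ _) IHv // IHu //; apply: hurwitz_word_inv.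
- move=> i b t tI; apply/val_inj/(@eq_from_nth _ 1) => [|j _]; rewrite ?size_tuple //.
  have iS : (i == i.+1 :> nat) = false by rewrite ltn_eqF.
  have Si : (i.+1 == i :> nat) = false by rewrite gtn_eqF.
  case: b; rewrite /= !(nth_sigma, nth_sigmaV) !eqxx ?Si ?iS.
    case: (j =P i :> nat) => [->|_]; last by case: (j =P i.+1 :> nat) => [->|].
    by rewrite !mulgA tI mul1g -mulgA tI mulg1.
  case: (j =P i :> nat) => [->|_] //; case: (j =P i.+1 :> nat) => [->|//].
  by rewrite !mulgA tI mul1g -mulgA tI mulg1.
move=> _ _ [i j ij|i j ij] t tI;
  apply/val_inj/(@eq_from_nth _ 1) => [|k _]; rewrite ?size_tuple //=.
  have D : [/\ (i == j :> nat) = false, (i == j.+1 :> nat) = false,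
      (i.+1 == j :> nat) = false & (i.+1 == j.+1 :> nat) = false].
    case/orP: ij => h; split.
    - by rewrite ltn_eqF // ltnW.
    - by rewrite ltn_eqF // ltnS ltnW // ltnW.
    - by rewrite ltn_eqF.
    - by rewrite ltn_eqF // ltnS ltnW.
    - by rewrite gtn_eqF // ltnW.
    - by rewrite gtn_eqF.
    - by rewrite gtn_eqF // ltnS ltnW // ltnW.
    by rewrite gtn_eqF // ltnS ltnW.
  case: D => D1 D2 D3 D4.
  rewrite !nth_sigma [j == i :> nat]eq_sym [j.+1 == i :> nat]eq_sym.
  rewrite [j == i.+1 :> nat]eq_sym [j.+1 == i.+1 :> nat]eq_sym D1 D2 D3 D4.
  case: (k =P i :> nat) => [->|ki]; first by rewrite D1 D2.
  by case: (k =P i.+1 :> nat) => [->|kj]; first by rewrite D3 D4.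
have cmp := (eqSS, eqxx, (ltn_eqF (ltnSn i)), (gtn_eqF (ltnSn i)),
  (ltn_eqF (ltnSn i.+1)), (gtn_eqF (ltnSn i.+1)),
  (ltn_eqF (ltnW (ltnSn i.+1))), (gtn_eqF (ltnW (ltnSn i.+1)))).
rewrite !nth_sigma ij !cmp /=.
case: (k =P i :> nat) => [->|ki].
  by rewrite !cmp !mulgA; do 2!rewrite -(mulgA _ (nth 1 t i) (nth 1 t i)) tI mulg1.
by case: (k == i.+1); case: (k == i.+2).
Qed.

Lemma hurwitz_class u t : involutive_tuple t ->
  hurwitz (pg_class (@braid_rel n) u) t = hurwitz_word u t.
Proof. by move=> tI; apply: hurwitz_word_eq tI; apply: word_eq_repr. Qed.

Lemma hurwitz1 t : involutive_tuple t -> hurwitz 1 t = t.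
Proof. by move=> tI; rewrite [LHS]hurwitz_class. Qed.

Lemma hurwitzM a b t :
  involutive_tuple t -> hurwitz (a * b) t = hurwitz a (hurwitz b t).
Proof.
by move=> tI; rewrite [LHS]hurwitz_class // /hurwitz_word foldr_cat.
Qed.

End Hurwitz.

Definition hurwitz_transitive (W : groupType) (T : set W) (w : W) : Prop :=
  forall t u : (refl_length T w).-tuple W, Red T w t -> Red T w u ->
    exists b : braid_group (refl_length T w), hurwitz b t = u.

(* Main.v *)
Require Import Defs.
From mathcomp Require Import all_boot.
From mathcomp Require Import boolp classical_sets.

Set Implicit Arguments.
Unset Strict Implicit.
Unset Printing Implicit Defensive.

Local Open Scope group_scope.

(** Read a factorization [t_1 ... t_k] of [c] into reflections as the path of
    suffix products [1, t_k, t_(k-1) t_k, ..., c], each step of which changes the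
    Coxeter length.  If two consecutive steps [y -> b y -> a b y] first go up and
    then down, then [a] and [b] both shorten the peak [x = b y].

    Suppose [a <> b].  A braid generator and its inverse, applied repeatedly,
    replace [(a, b)] by [(z a, z b)] for any power [z] of [a b], and the peak
    [x] by [z x].  Some such [z x] is shorter than [x] (lemma [peak_lowering]).
    Otherwise no reflection of the dihedral group generated by [a] and [b] could
    shorten [a x] or [b x], since that would lead to a [z x] shorter than [x].
    So by the cocycle rule for inversion sets, [b a] has no inversion in this
    dihedral group, which forces [a = b] (lemma [inversion_free_trivial]).

    Lowering peaks decreases the sum of the lengths along the path, so it stops:
    either at an adjacent pair of equal reflections, which may be deleted, or at
    a path that only goes up, as it starts at [1] (lemma [hurwitz_increasing]).
    In the second case the first reflection [a] of the factorization is an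
    inversion of [c = s_1 ... s_n], hence by the exchange condition
    [a = (s_1 ... s_(i-1)) s_i (s_1 ... s_(i-1))^-1], and the remaining ones
    factorize the product of the [s_j], [j <> i].  By induction they can be
    braided to these [s_j], and braiding [a] to the right, past
    [s_1, ..., s_(i-1)], turns it into [s_i].  This gives [s_1, ..., s_n], so the
    path had exactly [n] steps.  Since deleting an equal pair costs two steps,
    every factorization of [c] has at least [n] factors, and one with [n] factors
    never meets an equal pair (lemma [hurwitz_simple]).

    The inversions of [w] are the reflections that occur an odd number of times
    in the list of reflections read off from a word of [w].  The parity depends
    only on [w] because in the list read off from a relator
    [(s_i s_j)^k] the second half repeats the first. *)

(** * Involutions and the dihedral group that two of them generate *)

Lemma invol_inv (G : groupType) (x : G) : x * x = 1 -> x^-1 = x.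
Proof. exact: mulg1_eq. Qed.

Lemma invol_conj (G : groupType) (x y : G) : x * x = 1 -> x ^ y * x ^ y = 1.
Proof. by move=> xx; rewrite -conjMg xx conj1g. Qed.

Lemma eq_conjg (G : groupType) (t u x : G) : (t ^ u == x) = (t == x ^ u^-1).
Proof. by rewrite (can2_eq (conjgK u) (conjgKV u)). Qed.

Lemma multiplicative1 (G H : groupType) (f : {multiplicative G -> H}) : f 1 = 1.
Proof. by apply: (mulgI (f 1)); rewrite -gmulfM !mulg1. Qed.

Inductive cyclic_subgroup (G : groupType) (x : G) : G -> Prop :=
| cyclic1 : cyclic_subgroup x 1
| cyclicM z : cyclic_subgroup x z -> cyclic_subgroup x (z * x)
| cyclicV z : cyclic_subgroup x z -> cyclic_subgroup x (z * x^-1).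

Lemma cyclic_subgroup_id (G : groupType) (x : G) : cyclic_subgroup x x.
Proof. by rewrite -[X in cyclic_subgroup _ X]mul1g; apply/cyclicM/cyclic1. Qed.

Lemma cyclic_subgroupM (G : groupType) (x y z : G) :
  cyclic_subgroup x y -> cyclic_subgroup x z -> cyclic_subgroup x (y * z).
Proof.
move=> xy; elim=> {z} [|z _ IH|z _ IH]; rewrite ?mulg1 ?mulgA //; by constructor.
Qed.

Lemma cyclic_commute (G : groupType) (x z : G) :
  cyclic_subgroup x z -> commute x z.
Proof.
elim=> {z} [|z _ IH|z _ IH]; first exact: commute1.
  exact: commuteM.
by apply: commuteM => //; apply/commuteV.
Qed.

Lemma cyclic_subgroupV (G : groupType) (x z : G) :
  cyclic_subgroup x z -> cyclic_subgroup x z^-1.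
Proof.
elim=> {z} [|z _ IH|z _ IH]; first by rewrite invg1; constructor.
  rewrite invgM; apply: cyclic_subgroupM => //.
  by rewrite -[x^-1]mul1g; constructor; constructor.
by rewrite invgM invgK; apply: cyclic_subgroupM => //; apply: cyclic_subgroup_id.
Qed.

Lemma cyclic_conj_inv (G : groupType) (a b z : G) : a * a = 1 -> b * b = 1 ->
  cyclic_subgroup (a * b) z -> z ^ a = z^-1.
Proof.
move=> aa bb; have [aV bV] := (invol_inv aa, invol_inv bb).
have rho : (a * b) ^ a = (a * b)^-1 by rewrite conjgE invgM aV bV !mulgA aa mul1g.
elim=> {z} [|z cz IH|z cz IH]; first by rewrite conj1g invg1.
  by rewrite conjMg IH rho -invgM (cyclic_commute cz).
rewrite conjMg IH conjVg rho -invgM; congr (_^-1).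
exact/commute_sym/commuteV/commute_sym/cyclic_commute.
Qed.

(** Conjugation by [a] inverts [z], so the second [z] cancels the first. *)
Lemma cyclic_shift_mul (G : groupType) (a b z : G) : a * a = 1 -> b * b = 1 ->
  cyclic_subgroup (a * b) z -> z * a * (z * b) = a * b.
Proof.
move=> aa bb /(cyclic_conj_inv aa bb); rewrite conjgE (invol_inv aa) => zV.
by rewrite -[RHS](mulVKg z) -zV !mulgA -(mulgA _ a a) aa mulg1.
Qed.

(** The coset of the rotations that contains [a] and [b].  It is closed under
    products of three factors, which is the only trace of the dihedral structure
    left in [inversion_free_trivial]. *)
Definition dihedral_reflection (G : groupType) (a b f : G) : Prop :=
  cyclic_subgroup (a * b) (a * f).

Lemma dihedral_reflection_mul3 (G : groupType) (a b f g h : G) :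
  a * a = 1 -> b * b = 1 ->
  dihedral_reflection a b f -> dihedral_reflection a b g ->
  dihedral_reflection a b h -> dihedral_reflection a b (f * g * h).
Proof.
move=> aa bb Df Dg Dh; rewrite /dihedral_reflection.
have -> : a * (f * g * h) = a * f * (a * g)^-1 * (a * h).
  rewrite -(cyclic_conj_inv aa bb Dg) conjgE (invol_inv aa) !mulgA.
  by rewrite -(mulgA _ a a) aa mulg1 -(mulgA _ a a) aa mulg1.
apply: cyclic_subgroupM => //; apply: cyclic_subgroupM => //.
exact: cyclic_subgroupV.
Qed.

Lemma dihedral_reflection_fst (G : groupType) (a b : G) :
  a * a = 1 -> dihedral_reflection a b a.
Proof. by rewrite /dihedral_reflection => ->; constructor. Qed.

Lemma dihedral_reflection_snd (G : groupType) (a b : G) :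
  dihedral_reflection a b b.
Proof. exact: cyclic_subgroup_id. Qed.

Lemma dihedral_reflection_rotate (G : groupType) (a b z f : G) :
  a * a = 1 -> b * b = 1 -> cyclic_subgroup (a * b) z ->
  dihedral_reflection a b f -> dihedral_reflection a b (z * f).
Proof.
move=> aa bb cz Df; rewrite /dihedral_reflection.
have -> : a * (z * f) = z^-1 * (a * f).
  rewrite -(cyclic_conj_inv aa bb cz) conjgE (invol_inv aa) !mulgA.
  by rewrite -(mulgA _ a a) aa mulg1.
by apply: cyclic_subgroupM => //; apply: cyclic_subgroupV.
Qed.

(** * Braid moves on lists of group elements *)

(** On lists, unlike on tuples of a fixed size, moves can be made inside a
    sublist; lemma [hurwitz_path_braid] translates back to the braid group. *)

Inductive hurwitz_path (G : groupType) : seq G -> seq G -> Prop :=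
| hurwitz_refl t : hurwitz_path t t
| hurwitz_trans t u v :
    hurwitz_path t u -> hurwitz_path u v -> hurwitz_path t v
| hurwitz_sigma_step u a b v :
    hurwitz_path (u ++ a :: b :: v) (u ++ a * b * a :: a :: v)
| hurwitz_sigmaV_step u a b v :
    hurwitz_path (u ++ a :: b :: v) (u ++ b :: b * a * b :: v).

Lemma hurwitz_path_cat (G : groupType) (w t u : seq G) :
  hurwitz_path t u -> hurwitz_path (w ++ t) (w ++ u).
Proof.
elim=> {t u} [t|t u v _ IH1 _ IH2|u a b v|u a b v]; rewrite ?catA; first by constructor.
- exact: hurwitz_trans IH2.
- exact: hurwitz_sigma_step.
exact: hurwitz_sigmaV_step.
Qed.

Lemma hurwitz_path_size (G : groupType) (t u : seq G) :
  hurwitz_path t u -> size t = size u.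
Proof. by elim=> {t u} [|t u v _ -> _ ->|u a b v|u a b v] //; rewrite !size_cat. Qed.

(** A braid generator multiplies both entries on the left by [a * b], since
    [a * b * a = (a * b) * a] and [a = (a * b) * b]; its inverse multiplies them
    by [b * a]. *)
Lemma hurwitz_path_dihedral (G : groupType) (u v : seq G) a b z :
  a * a = 1 -> b * b = 1 -> cyclic_subgroup (a * b) z ->
  hurwitz_path (u ++ a :: b :: v) (u ++ z * a :: z * b :: v).
Proof.
move=> aa bb; elim=> {z} [|z cz IH|z cz IH]; first by rewrite !mul1g; constructor.
  apply: hurwitz_trans IH _.
  have -> : z * (a * b) * a = z * a * (z * b) * (z * a).
    by rewrite (cyclic_shift_mul aa bb cz) [RHS]mulgA (cyclic_commute cz).
  have -> : z * (a * b) * b = z * a by rewrite -!mulgA bb mulg1.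
  exact: hurwitz_sigma_step.
apply: hurwitz_trans IH _.
rewrite invgM (invol_inv aa) (invol_inv bb).
have -> : z * (b * a) * a = z * b by rewrite -!mulgA aa mulg1.
have -> : z * (b * a) * b = z * b * (z * a) * (z * b).
  by rewrite -(mulgA (z * b)) (cyclic_shift_mul aa bb cz) !mulgA.
exact: hurwitz_sigmaV_step.
Qed.

Lemma nth_cat_pair (G : groupType) (u v : seq G) x y x' y' j :
  nth 1 (u ++ x :: y :: v) j =
  if j == size u then x else if j == (size u).+1 then y
  else nth 1 (u ++ x' :: y' :: v) j.
Proof.
elim: u j => [|z u IH] [|j] //=.
by case: j => [|j].
Qed.

Lemma hurwitz_path_braid (G : groupType) n (t : n.-tuple G) (u : seq G) :
  hurwitz_path t u -> involutive_tuple t ->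
  exists b : braid_group n, hurwitz b t = u :> seq G.
Proof.
have [x tx] : exists x, x = tval t by exists t.
rewrite -tx => tu; elim: tu t tx => {x u}.
- by move=> x t -> tI; exists 1; rewrite hurwitz1.
- move=> x y z _ IH1 _ IH2 t tx tI; have [b1 b1E] := IH1 _ tx tI.
  have [|b2 b2E] := IH2 _ (esym b1E); first exact: hurwitz_word_inv.
  by exists (b2 * b1); rewrite hurwitzM.
all: move=> u a b v t tx tI.
all: have ltu : (size u < n.-1)%N by
  rewrite -(size_tuple t) -tx size_cat /= addnS /= addnS ltnS leq_addr.
all: have ta : nth 1 t (size u) = a by rewrite -tx nth_cat ltnn subnn.
all: have tb : nth 1 t (size u).+1 = b by
  rewrite -tx nth_cat ltnNge leqnSn /= subSnn.
- exists (pg_class (@braid_rel n) [:: (Ordinal ltu, true)]).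
  rewrite hurwitz_class // -[hurwitz_word _ _]/(hurwitz_sigma (Ordinal ltu) t).
  apply: (@eq_from_nth _ 1) => [|j _].
    by rewrite size_tuple -(size_tuple t) -tx !size_cat.
  by rewrite nth_sigma /= ta tb -tx [RHS](nth_cat_pair _ _ _ _ a b).
exists (pg_class (@braid_rel n) [:: (Ordinal ltu, false)]).
rewrite hurwitz_class // -[hurwitz_word _ _]/(hurwitz_sigmaV (Ordinal ltu) t).
apply: (@eq_from_nth _ 1) => [|j _].
  by rewrite size_tuple -(size_tuple t) -tx !size_cat.
by rewrite nth_sigmaV /= ta tb -tx [RHS](nth_cat_pair _ _ _ _ a b).
Qed.

(** * Inversions, word length and the exchange condition *)

Section CoxeterSystem.
Variables (W : groupType) (m : nat) (s : m.-tuple W).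
Hypothesis sys : coxeter_system s.

Definition word_prod (u : seq 'I_m) : W := \prod_(i <- u) tnth s i.

(** The parity of the number of positions [p] of the word [u = i_1 ... i_k] with
    [t = (s_(i_1) ... s_(i_(p-1))) s_(i_p) (s_(i_1) ... s_(i_(p-1)))^-1]. *)
Fixpoint occ_parity (u : seq 'I_m) (t : W) : bool :=
  if u is i :: v then (t == tnth s i) (+) occ_parity v (t ^ tnth s i) else false.

Lemma word_prod_cons i u : word_prod (i :: u) = tnth s i * word_prod u.
Proof. exact: big_cons. Qed.

Lemma word_prod_cat u v : word_prod (u ++ v) = word_prod u * word_prod v.
Proof. exact: big_cat. Qed.

Lemma occ_parity_cat u v t :
  occ_parity (u ++ v) t = occ_parity u t (+) occ_parity v (t ^ word_prod u).
Proof.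
elim: u t => [|i u IH] t /=; first by rewrite /word_prod big_nil conjg1.
by rewrite IH word_prod_cons conjgM addbA.
Qed.

Lemma gen_uniq : injective (tnth s).
Proof. by case: sys => us _; apply/tuple_uniqP. Qed.

Lemma gen_invol i : tnth s i * tnth s i = 1.
Proof.
case: sys => _ [M [[Mii _ _] [phi [_ phiE]]]].
rewrite -phiE -gmulfM [X in phi X]pg_mulE.
transitivity (phi 1); last exact: multiplicative1.
congr (phi _); apply/pg_classP/word_eq_rel.
exact: (CoxeterRel (Mii i)).
Qed.

Lemma genV i : (tnth s i)^-1 = tnth s i.
Proof. exact/invol_inv/gen_invol. Qed.

Lemma gen_conj_self i : tnth s i ^ tnth s i = tnth s i.
Proof. by rewrite conjgE mulKg. Qed.

Lemma occ_parity_power i j k t :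
  occ_parity (flatten (nseq k [:: i; j])) t =
  \big[addb/false]_(0 <= q < k.*2)
    (t == (tnth s i * tnth s j) ^+ q * tnth s i).
Proof.
set p := _ * _; elim: k t => [|k IH] t; first by rewrite big_nil.
rewrite doubleS !big_nat_recl //= -conjgM -/p IH mul1g; congr (_ (+) (_ (+) _)).
  by rewrite eq_conjg conjgE invgK mulgA genV.
apply: eq_bigr => q _; rewrite eq_conjg [_ ^ p^-1]conjgE invgK; congr (_ == _).
have -> : p ^+ q.+2 = p * (p ^+ q * p) by rewrite !(expgS, =^~ expgSr).
rewrite -[RHS]mulgA; congr (p * _); rewrite -mulgA -[RHS]mulgA; congr (_ * _).
by rewrite /p invgM !genV !mulgA.
Qed.

(** The list of reflections has period [k] by the previous lemma, and length
    [2 k]; so every reflection occurs an even number of times, also when [k] is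
    not the order of [s_i * s_j]. *)
Lemma occ_parity_relator i j k t :
  (tnth s i * tnth s j) ^+ k = 1 ->
  occ_parity (flatten (nseq k [:: i; j])) t = false.
Proof.
move=> pk1; rewrite occ_parity_power -addnn (big_cat_nat (leq0n k)) ?leq_addr //=.
rewrite -{2}[k]add0n big_addn addnK; set b := \big[_/_]_(_ <= _ < _) _.
rewrite [X in _ (+) X](_ : _ = b) ?addbb //.
by apply: eq_bigr => q _; rewrite expgnDr pk1 mulg1.
Qed.

Lemma word_prod_power i j k :
  word_prod (flatten (nseq k [:: i; j])) = (tnth s i * tnth s j) ^+ k.
Proof.
elim: k => [|k IH]; first exact: big_nil.
by rewrite /= !word_prod_cons IH mulgA expgS.
Qed.

(** The generators being involutions, the exponents of the letters of a word in
    the presentation can be forgotten. *)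
Lemma coxeter_presentation : exists M (phi : {multiplicative coxeter_group M -> W}),
  bijective phi /\ forall x,
    phi (pg_class (coxeter_rel M) x) = word_prod (map (fun l => l.1) x).
Proof.
case: sys => _ [M [_ [phi [phi_bij phiE]]]]; exists M, phi; split=> //.
elim=> [|[i b] x IH]; first by rewrite /word_prod big_nil; apply: multiplicative1.
rewrite /= word_prod_cons -IH -cat1s -pg_mulE.
rewrite [LHS](gmulfM (s := phi)); congr (_ * _); case: b; first exact: phiE.
apply: (mulIg (tnth s i)); rewrite gen_invol -{1}phiE -(gmulfM (s := phi)).
rewrite -[RHS](multiplicative1 phi) [X in phi X]pg_mulE.
congr (phi _); apply/pg_classP.
exact: (word_eq_cancel _ i false).
Qed.

Lemma word_prod_surj w : exists u, word_prod u = w.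
Proof.
have [M [phi [[psi _ psiK] phiE]]] := coxeter_presentation.
rewrite -[w]psiK; elim/pg_class_ind: (psi w) => u.
by exists (map (fun l => l.1) u).
Qed.

(** By [occ_parity_cat] the pair of product and parity is multiplicative under
    concatenation, so it is enough to test it on the defining relations. *)
Lemma occ_parity_word_prod u v :
  word_prod u = word_prod v -> occ_parity u =1 occ_parity v.
Proof.
have [M [phi [phi_bij phi_class]]] := coxeter_presentation.
pose R := coxeter_rel M; pose sg := map (fun l : 'I_m * bool => l.1).
have relP x y : R x y -> occ_parity (sg x) =1 occ_parity (sg y).
  case=> i j k Mij t; rewrite /sg map_flatten map_nseq /=.
  apply: occ_parity_relator; rewrite -word_prod_power.
  have := phi_class (flatten (nseq k [:: (i, true); (j, true)])).
  rewrite map_flatten map_nseq /= => <-.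
  rewrite -[RHS](multiplicative1 phi); congr (phi _).
  by apply/pg_classP/word_eq_rel/CoxeterRel.
have eqP x y : word_eq R x y -> occ_parity (sg x) =1 occ_parity (sg y).
  elim=> {x y} //.
  - by move=> x y _ IH t; rewrite IH.
  - by move=> x y z _ IHx _ IHy t; rewrite IHx.
  - move=> x x' y y' xx' IHx _ IHy t.
    rewrite /sg !map_cat !occ_parity_cat IHx IHy.
    by rewrite -!phi_class; have /pg_classP -> := xx'.
  - by move=> i b t /=; rewrite eq_conjg genV gen_conj_self addbF addbb.
pose lift := map (fun i : 'I_m => (i, true)).
have liftK : cancel lift sg by move=> x; rewrite /sg -map_comp map_id.
move=> uv t; rewrite -(liftK u) -(liftK v); apply: eqP; apply/pg_classP.
have phi_lift w : phi (pg_class R (lift w)) = word_prod w.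
  by rewrite phi_class -map_comp map_id.
by apply: (bij_inj phi_bij); rewrite !phi_lift.
Qed.

Lemma shortest_word w : exists u, word_prod u = w /\
  forall v, word_prod v = w -> (size u <= size v)%N.
Proof.
have exk : exists k, `[< exists2 u, word_prod u = w & size u = k >].
  by have [u uw] := word_prod_surj w; exists (size u); apply/asboolP; exists u.
have [k /asboolP [u uw uk] kmin] := ex_minnP exk; exists u; split=> // v vw.
by rewrite uk; apply: kmin; apply/asboolP; exists v.
Qed.

Definition reduced_word w : seq 'I_m := sval (cid (shortest_word w)).

Definition word_length w : nat := size (reduced_word w).

Definition is_inversion (w t : W) : bool := occ_parity (reduced_word w) t.

Definition reflection (t : W) : Prop := reflections s t.

Lemma reduced_wordK w : word_prod (reduced_word w) = w.
Proof. by rewrite /reduced_word; case: cid => u []. Qed.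

Lemma word_length_le u : (word_length (word_prod u) <= size u)%N.
Proof. by rewrite /word_length /reduced_word; case: cid => v /= [_ vmin]; apply: vmin. Qed.

Lemma is_inversionE u t : is_inversion (word_prod u) t = occ_parity u t.
Proof. exact/occ_parity_word_prod/reduced_wordK. Qed.

Lemma is_inversion1 t : is_inversion 1 t = false.
Proof. by have := is_inversionE [::] t; rewrite /word_prod big_nil. Qed.

Lemma is_inversionM u v t :
  is_inversion (u * v) t = is_inversion u t (+) is_inversion v (t ^ u).
Proof.
rewrite -(reduced_wordK u) -(reduced_wordK v) -word_prod_cat !is_inversionE.
exact: occ_parity_cat.
Qed.

Lemma is_inversionV u t : is_inversion u^-1 t = is_inversion u (t ^ u^-1).
Proof.
have := is_inversionM u^-1 u t; rewrite mulVg is_inversion1.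
by case: (is_inversion _ _); case: (is_inversion _ _).
Qed.

Lemma is_inversion_gen i t : is_inversion (tnth s i) t = (t == tnth s i).
Proof.
have := is_inversionE [:: i] t.
by rewrite word_prod_cons /word_prod big_nil mulg1 => ->; rewrite /= addbF.
Qed.

Lemma reflection_gen i : reflection (tnth s i).
Proof. by exists 1, (tnth s i); rewrite mem_tnth mul1g invg1 mulg1. Qed.

Lemma reflection_word t : reflection t ->
  exists u i, t = tnth s i ^ word_prod u.
Proof.
case=> w [_ [/tnthP [i ->] ->]]; have [u uw] := word_prod_surj w^-1.
by exists u, i; rewrite uw conjgE invgK mulgA.
Qed.

Lemma reflectionJ t w : reflection t -> reflection (t ^ w).
Proof.
case=> v [x [xs ->]]; exists (w^-1 * v), x; split=> //.
by rewrite conjgE invgM invgK !mulgA.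
Qed.

Lemma reflection_invol t : reflection t -> t * t = 1.
Proof. by case/reflection_word=> u [i ->]; apply/invol_conj/gen_invol. Qed.

Lemma reflectionV t : reflection t -> t^-1 = t.
Proof. by move=> Tt; apply/invol_inv/reflection_invol. Qed.

(** In the expansion of [t = w^-1 * s_i * w] by the cocycle rule, the
    contributions of [w] and [w^-1] cancel. *)
Lemma is_inversion_self t : reflection t -> is_inversion t t.
Proof.
case/reflection_word=> u [i ->]; set w := word_prod u; rewrite {1}conjgE.
rewrite !is_inversionM is_inversionV conjgK.
by rewrite is_inversion_gen eqxx gen_conj_self addbCA addbb.
Qed.

(** With [delete_letter], the exchange condition: an odd number of occurrences
    is at least one, and deleting the letter at which [t] occurs multiplies the
    word on the left by [t]. *)
Lemma strong_exchange u t : occ_parity u t ->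
  exists u1 i u2, u = u1 ++ i :: u2 /\ t ^ word_prod u1 = tnth s i.
Proof.
elim: u t => [|i u IH] t //=; case: eqP => [-> _|_ /= /IH].
  by exists [::], i, u; rewrite /word_prod big_nil conjg1.
case=> u1 [j [u2 [-> tj]]]; exists (i :: u1), j, u2; split=> //.
by rewrite word_prod_cons conjgM.
Qed.

Lemma delete_letter u1 i u2 t : reflection t -> t ^ word_prod u1 = tnth s i ->
  t * word_prod (u1 ++ i :: u2) = word_prod (u1 ++ u2).
Proof.
move=> Tt ti; rewrite !word_prod_cat word_prod_cons -ti conjgE -!mulgA mulVKg.
by rewrite !mulgA reflection_invol // mul1g.
Qed.

Lemma inversion_shortens w t : reflection t -> is_inversion w t ->
  (word_length (t * w) < word_length w)%N.
Proof.
move=> Tt /strong_exchange [u1 [i [u2 [wE ti]]]].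
rewrite -{1}(reduced_wordK w) wE delete_letter //.
by rewrite /word_length wE (leq_ltn_trans (word_length_le _)) // !size_cat /= addnS.
Qed.

Lemma is_inversionMl w t : reflection t -> is_inversion (t * w) t = ~~ is_inversion w t.
Proof. by move=> Tt; rewrite is_inversionM is_inversion_self // conjgE mulKg. Qed.

(** * Lowering a peak *)

(** The typical [P] is the set of reflections of a dihedral subgroup.  By induction on
    the length of a word that conjugates [d] to a simple reflection, [P] can be
    conjugated until it contains a simple reflection: the conjugation by [s_j]
    carries along the inversions in [P] as long as [s_j] is not in [P], because
    [s_j] is the only inversion of [s_j].  If [s_j] is in [P], the pair [(d, e)]
    can be replaced by [(s_j, s_j * d * e)], with the same product. *)
Lemma inversion_free_trivial (P : W -> Prop) d e :
  (forall f, P f -> reflection f) ->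
  (forall f g h, P f -> P g -> P h -> P (f * g * h)) ->
  P d -> P e -> (forall f, P f -> ~~ is_inversion (d * e) f) -> d = e.
Proof.
move=> PT P3 Pd Pe noinv.
have [u [i]] := reflection_word (PT _ Pd).
(* If s_j * g has no inversion in Q, then in Q the reflections s_j and g have
   the same inversions: those of s_j, that is s_j alone; but g is one of g. *)
have base (Q : W -> Prop) j g : (forall f, Q f -> reflection f) ->
    (forall f g h, Q f -> Q g -> Q h -> Q (f * g * h)) ->
    Q (tnth s j) -> Q g -> (forall f, Q f -> ~~ is_inversion (tnth s j * g) f) ->
    tnth s j = g.
  move=> QT Q3 Qj Qg ninv_g; have := is_inversion_self (QT _ Qg).
  rewrite -{1}[g](mulKg (tnth s j)) genV is_inversionM is_inversion_gen.
  rewrite (negbTE (ninv_g _ _)) ?addbF => [/eqP -> //|].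
  by rewrite conjgE genV mulgA; apply: Q3.
elim/last_ind: u d e P PT P3 Pd Pe noinv => [|u j IH] d e P PT P3 Pd Pe noinv dE.
  rewrite /word_prod big_nil conjg1 in dE; rewrite dE in Pd noinv *.
  exact: base noinv.
have [Pj|nPj] := pselect (P (tnth s j)).
  have : tnth s j = tnth s j * d * e.
    apply: (base P) => //; first exact: P3.
    by move=> f Pf; rewrite !mulgA gen_invol mul1g noinv.
  rewrite -mulgA -{1}[tnth s j]mulg1 => /mulgI de1; apply: (mulIg e).
  by rewrite -de1 reflection_invol //; apply: PT.
pose Q f := P (f ^ tnth s j).
have jj : tnth s j * tnth s j = 1 := gen_invol j.
have JK f : (f ^ tnth s j) ^ tnth s j = f by rewrite -conjgM jj conjg1.
apply: (@conjg_inj _ (tnth s j)); apply: (IH _ _ Q); rewrite /Q ?JK //.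
- by move=> f /PT Tf; rewrite -(JK f); exact: reflectionJ.
- by move=> f g h Qf Qg Qh; rewrite !conjMg; apply: P3.
- move=> f Pf; rewrite -conjMg [_ ^ tnth s j]conjgE genV.
  rewrite is_inversionM is_inversion_gen is_inversionM is_inversion_gen.
  rewrite (negbTE (noinv _ Pf)) addFb; set g := f ^ _ in Pf *.
  have /negbTE -> : f != tnth s j.
    by apply: contra_notN nPj => /eqP fj; rewrite -[tnth s j]gen_conj_self -{1}fj.
  have /negbTE -> // : g ^ (d * e) != tnth s j.
  apply: contra_notN nPj => /eqP <-; rewrite conjgE invgM !reflectionV; try exact: PT.
  have -> : e * d * (g * (d * e)) = e * (d * g * d) * e by rewrite !mulgA.
  by apply: (P3) => //; apply: P3.
by rewrite dE -cats1 word_prod_cat word_prod_cons /word_prod big_nil mulg1 conjgM JK.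
Qed.

(** Every [a * z] is conjugate to [a] or to [b]: conjugation by [a * b] changes
    the exponent of [z] by two, hence the induction on two successive powers. *)
Lemma dihedral_reflectionP a b f : reflection a -> reflection b ->
  dihedral_reflection a b f -> reflection f.
Proof.
move=> Ta Tb; have [aa bb] := (reflection_invol Ta, reflection_invol Tb).
set r := a * b; have rV : r^-1 = b * a by rewrite invgM !reflectionV.
suff key z : cyclic_subgroup r z -> reflection (a * z) /\ reflection (a * z * r).
  by move=> /key []; rewrite mulgA aa mul1g.
have conj_r y : commute r y -> (a * y) ^ r = a * y * r * r.
  have ar : a ^ r = a * (r * r).
    by rewrite conjgE rV /r !mulgA -(mulgA b) aa mulg1 mul1g.
  move=> ry; rewrite conjMg ar [y ^ r]conjgE -ry mulKg.
  by rewrite -(mulgA a (r * r) y) -(mulgA r r y) ry (mulgA r y r) ry !(mulgA a).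
elim=> [|y cy [IH1 IH2]|y cy [IH1 IH2]].
- by rewrite mulg1 mulgA aa mul1g.
- rewrite (mulgA a y r); split=> //; rewrite -conj_r; first exact: reflectionJ.
  exact: cyclic_commute.
rewrite -(mulgA a _ r) mulgVK; split=> //.
rewrite -(conjgK r (a * (y / r))) conj_r -?(mulgA a _ r) ?mulgVK; last first.
  by apply: commuteM; [apply: cyclic_commute | apply/commuteV/commute_refl].
by rewrite (mulgA a y r); apply: reflectionJ.
Qed.

(** If every [z * x] were at least as long as [x], then neither [a * x] nor
    [b * x] would have an inversion among the reflections [P] of the dihedral
    group; so neither would [b * a], their quotient, and [a = b]. *)
Lemma peak_lowering x a b : reflection a -> reflection b -> a <> b ->
  is_inversion x a -> is_inversion x b ->
  exists2 z, cyclic_subgroup (a * b) z &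
    (word_length (z * x) < word_length x)%N.
Proof.
move=> Ta Tb ab xa xb; apply: contrapT => nolower; apply: ab.
have [aa bb] := (reflection_invol Ta, reflection_invol Tb).
pose P := dihedral_reflection a b.
have PT f : P f -> reflection f by apply: dihedral_reflectionP.
have P3 f g h : P f -> P g -> P h -> P (f * g * h).
  exact: dihedral_reflection_mul3.
have Pa : P a by apply: dihedral_reflection_fst.
have Pb : P b by apply: dihedral_reflection_snd.
have P_rot f g : P f -> P g -> cyclic_subgroup (a * b) (f * g).
  move=> Pf Pg; have := P3 _ _ _ Pa Pf Pg.
  by rewrite /P /dihedral_reflection !mulgA aa mul1g.
(* A further reflection f that shortens g * x would make f * g * x shorter than
   x, with f * g a rotation. *)
have low g : P g -> is_inversion x g ->
    forall f, P f -> ~~ is_inversion (g * x) f.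
  move=> Pg xg f Pf; apply/negP => /(inversion_shortens (PT _ Pf)) lt.
  apply: nolower; exists (f * g); first exact: P_rot.
  by rewrite -mulgA (ltn_trans lt) // inversion_shortens //; apply: PT.
apply/esym/(inversion_free_trivial PT P3) => // f Pf.
have := low b Pb xb f Pf; have -> : b * x = b * a * (a * x).
  by rewrite !mulgA -(mulgA b) aa mulg1.
rewrite is_inversionM (negbTE (low a Pa xa _ _)) ?addbF //.
rewrite conjgE invgM !reflectionV //.
have -> : a * b * (f * (b * a)) = a * (b * f * b) * a by rewrite !mulgA.
by apply: (P3) => //; apply: P3.
Qed.

(** * Simple reflections outside a standard parabolic subgroup *)

Lemma word_prod_rev u : word_prod (rev u) = (word_prod u)^-1.
Proof.
elim: u => [|i u IH]; first by rewrite /word_prod big_nil invg1.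
rewrite rev_cons -cats1 word_prod_cat IH !word_prod_cons invgM genV.
by rewrite /word_prod big_nil mulg1.
Qed.

Lemma gen_neq1 i : tnth s i <> 1.
Proof.
by move=> si1; have := is_inversion_gen i (tnth s i); rewrite eqxx {1}si1 is_inversion1.
Qed.

(** The first letter [j] of [u] is not an inversion of [s_i], so [s_j] occurs
    once more in the list of reflections of [u]; by the exchange condition a
    second letter cancels with the first, which leaves a shorter word for
    [s_i]. *)
Lemma gen_notin_word u i : i \notin u -> word_prod u <> tnth s i.
Proof.
have [n] := ubnP (size u); elim: n u => // n IH [|j u] /=.
  by move=> _ _; rewrite /word_prod big_nil => /esym/gen_neq1.
rewrite ltnS inE negb_or => ltun /andP[ij iu] uE.
have := is_inversionE (j :: u) (tnth s j); rewrite uE is_inversion_gen /=.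
rewrite eqxx gen_conj_self (inj_eq gen_uniq) eq_sym (negbTE ij) /= => /esym/negbFE.
case/strong_exchange=> u1 [k [u2 [def_u]]].
move/(delete_letter u2 (reflection_gen j)); rewrite -def_u -word_prod_cons uE.
apply/nesym/IH.
  by apply: leq_trans ltun; rewrite def_u !size_cat /= addnS.
by move: iu; rewrite def_u !mem_cat inE !negb_or => /and3P[-> _ ->].
Qed.

(** An occurrence of [s_i] in the list of reflections of [u] would write [s_i] as
    a palindrome in the letters of [u]. *)
Lemma occ_parity_notin u i : i \notin u -> ~~ occ_parity u (tnth s i).
Proof.
move=> iu; apply/negP => /strong_exchange[u1 [k [u2 [def_u uk]]]].
apply: (@gen_notin_word (u1 ++ k :: rev u1) i).
  move: iu; rewrite def_u !mem_cat !inE mem_rev !negb_or => /and3P[-> -> _] //.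
rewrite word_prod_cat word_prod_cons word_prod_rev -uk conjgE !mulgA mulgV mul1g.
by rewrite mulgK.
Qed.

(** * Increasing factorizations *)

(** Each factor lengthens the product of those to its right. *)
Fixpoint increasing (t : seq W) : bool :=
  if t is a :: u then ~~ is_inversion (\prod_(x <- u) x) a && increasing u
  else true.

(** Going from right to left, the first factor [a] that shortens the product to
    its right cannot be the last one of [t], because [1] has no inversion; the
    factor [b] after it lengthens, so [b] is an inversion of the product that it
    begins. *)
Lemma not_increasing_peak (t : seq W) : (forall x, x \in t -> reflection x) ->
  ~~ increasing t -> exists u a b v, [/\ t = u ++ a :: b :: v,
    is_inversion (b * \prod_(x <- v) x) a & is_inversion (b * \prod_(x <- v) x) b].
Proof.
elim: t => [|a t IH] //= Tt.
have Tt' x : x \in t -> reflection x by move=> xt; apply: Tt; rewrite inE xt orbT.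
have [incr|nincr _] := boolP (increasing t); last first.
  have [u [b [c [v [-> ? ?]]]]] := IH Tt' nincr.
  by exists (a :: u), b, c, v.
case: t incr {IH} Tt Tt' => [|b t] /=; first by rewrite big_nil is_inversion1.
move=> /andP[bt _] _ Tt; rewrite big_cons andbT negbK => ta.
exists [::], a, b, t; split=> //; rewrite is_inversionMl //.
by apply: Tt; rewrite mem_head.
Qed.

Fixpoint suffix_weight (t : seq W) : nat :=
  if t is a :: u then (word_length (a * \prod_(x <- u) x) + suffix_weight u)%N
  else 0%N.

Lemma suffix_weight_cat u t t' :
  \prod_(x <- t') x = \prod_(x <- t) x -> (suffix_weight t' < suffix_weight t)%N ->
  (suffix_weight (u ++ t') < suffix_weight (u ++ t))%N.
Proof.
by move=> eq_tt' ltt; elim: u => //= a u IH; rewrite !big_cat eq_tt' ltn_add2l.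
Qed.

(** Replacing [(a, b)] by [(z * a, z * b)] at a peak keeps the product [a * b],
    so the peak is the only suffix product that changes. *)
Lemma hurwitz_increasing (t : seq W) : (forall x, x \in t -> reflection x) ->
  exists t', [/\ hurwitz_path t t', forall x, x \in t' -> reflection x,
    \prod_(x <- t') x = \prod_(x <- t) x &
    increasing t' \/ exists u a v, t' = u ++ a :: a :: v].
Proof.
have [n] := ubnP (suffix_weight t); elim: n t => // n IH t ltn Tt.
have [incr|nincr] := boolP (increasing t).
  by exists t; split; [constructor | | | left].
have [u [a [b [v [tE pa pb]]]]] := not_increasing_peak Tt nincr.
have [eqab|neqab] := pselect (a = b).
  exists t; split=> //; first by constructor.
  by right; exists u, a, v; rewrite tE eqab.
have Ta : reflection a by apply: Tt; rewrite tE mem_cat !inE eqxx orbT.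
have Tb : reflection b by apply: Tt; rewrite tE mem_cat !inE eqxx !orbT.
have [aa bb] := (reflection_invol Ta, reflection_invol Tb).
have [z cz ltz] := peak_lowering Ta Tb neqab pa pb.
have zab := cyclic_shift_mul aa bb cz.
have eq_prod : \prod_(x <- z * a :: z * b :: v) x = \prod_(x <- a :: b :: v) x.
  by rewrite !big_cons !(mulgA _ _ (\prod_(x <- v) x)) zab.
have [||t' [tt' Tt' pt' ct']] := IH (u ++ z * a :: z * b :: v).
- rewrite -ltnS; apply: leq_trans ltn; rewrite ltnS tE.
  apply: (suffix_weight_cat _ eq_prod) => /=.
  have := eq_prod; rewrite !big_cons => ->; rewrite ltn_add2l ltn_add2r.
  by rewrite -mulgA.
- move=> x; rewrite mem_cat !inE => /or4P[xu|/eqP->|/eqP->|xv].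
  - by apply: Tt; rewrite tE mem_cat xu.
  - apply: (dihedral_reflectionP Ta Tb); apply: dihedral_reflection_rotate => //.
    exact: dihedral_reflection_fst.
  - apply: (dihedral_reflectionP Ta Tb); apply: dihedral_reflection_rotate => //.
    exact: dihedral_reflection_snd.
  by apply: Tt; rewrite tE mem_cat !inE xv !orbT.
exists t'; split=> //; last by rewrite pt' tE !big_cat eq_prod.
by apply: hurwitz_trans tt'; rewrite tE; apply: hurwitz_path_dihedral.
Qed.

Lemma hurwitz_path_pass u a v :
  hurwitz_path (a :: map (tnth s) u ++ v) (map (tnth s) u ++ a ^ word_prod u :: v).
Proof.
elim: u a => [|i u IH] a /=; first by rewrite /word_prod big_nil conjg1; constructor.
apply: hurwitz_trans (hurwitz_sigmaV_step [::] _ _ _) _ => /=.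
have <- : a ^ tnth s i = tnth s i * a * tnth s i by rewrite conjgE genV mulgA.
rewrite word_prod_cons conjgM.
exact: (hurwitz_path_cat [:: _] (IH _)).
Qed.

(** * Factorizations of a product of distinct simple reflections *)

(** Because the letters of [u] are distinct, every word obtained from [u] by
    deleting letters satisfies the hypotheses again. *)
Lemma increasing_hurwitz_simple (t : seq W) u : (forall x, x \in t -> reflection x) ->
  increasing t -> uniq u -> \prod_(x <- t) x = word_prod u ->
  hurwitz_path t (map (tnth s) u).
Proof.
elim: t u => [|a t IH] u Tt.
  case: u => [|i u] _; first by constructor.
  rewrite big_nil cons_uniq => /andP[iu _] /esym u1.
  have := is_inversionE (i :: u) (tnth s i); rewrite u1 is_inversion1 /= eqxx.
  by rewrite gen_conj_self (negbTE (occ_parity_notin iu)).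
move=> /= /andP[ninv incr] uu; rewrite big_cons => tE.
have Ta : reflection a by apply: Tt; rewrite mem_head.
have := is_inversionE u a; rewrite -tE is_inversionMl // ninv => /esym.
case/strong_exchange=> u1 [i [u2 [def_u ai]]].
have := delete_letter u2 Ta ai; rewrite -def_u -tE mulgA reflection_invol // mul1g.
move=> tE'; rewrite def_u map_cat /= -ai.
apply: hurwitz_trans (hurwitz_path_pass _ _ _).
apply: (hurwitz_path_cat [:: a]); rewrite -map_cat; apply: IH => //.
  by move=> x xt; apply: Tt; rewrite inE xt orbT.
by move: uu; rewrite def_u -[i :: u2]cat1s uniq_catCA cat1s cons_uniq => /andP[].
Qed.

(** The bound on the size of [t] is proved together with the transitivity, since
    it is what excludes an equal pair in a factorization of minimal size. *)
Lemma hurwitz_simple (t : seq W) u : (forall x, x \in t -> reflection x) ->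
  uniq u -> \prod_(x <- t) x = word_prod u ->
  (size u <= size t)%N /\ (size t = size u -> hurwitz_path t (map (tnth s) u)).
Proof.
have [n] := ubnP (size t); elim: n t => // n IH t; rewrite ltnS => ltn Tt uu tE.
have [t' [tt' Tt' t'E ct']] := hurwitz_increasing Tt.
rewrite (hurwitz_path_size tt'); case: ct' => [incr|[v [a [w def_t']]]].
  have t'u : hurwitz_path t' (map (tnth s) u).
    by apply: increasing_hurwitz_simple => //; rewrite t'E.
  rewrite (hurwitz_path_size t'u) size_map; split=> // _.
  exact: hurwitz_trans t'u.
have Tvw x : x \in v ++ w -> reflection x.
  by move=> xvw; apply: Tt'; move: xvw; rewrite def_t' !mem_cat !inE => /orP[]->;
    rewrite ?orbT.
have aa : a * a = 1.
  by apply/reflection_invol/Tt'; rewrite def_t' mem_cat !inE eqxx orbT.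
have szt : size t' = (size (v ++ w)).+2 by rewrite def_t' !size_cat /= !addnS.
have [||le_u _] := IH (v ++ w) _ Tvw uu.
- by apply: leq_trans ltn; rewrite (hurwitz_path_size tt') szt.
- by rewrite -tE -t'E def_t' !big_cat !big_cons /= !(mulgA a) aa mul1g.
by rewrite szt; split; [rewrite !leqW | move=> szu; move: le_u; rewrite -szu ltnNge leqW].
Qed.

End CoxeterSystem.

Theorem theorem1p3 (W : groupType) (T : set W) (m : nat)
    (hWT : dual_coxeter_system T m)
    (s : m.-tuple W) (hs : simple_system T s)
    (n : nat) (hn : (n <= m)%N)
    (c : W) (hc : c = \prod_(x <- take n s) x) :
  hurwitz_transitive T c /\
  (forall t : n.-tuple W, (forall i, T (tnth t i)) -> c = \prod_(x <- t) x ->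
     exists b : braid_group n, hurwitz b t = take n s :> seq W).
Proof.
have [sys TE] := hs.
pose u := take n (enum 'I_m).
have uu : uniq u by rewrite take_uniq // enum_uniq.
have su : size u = n by rewrite size_takel // size_enum_ord.
have def_u : map (tnth s) u = take n s.
  by rewrite map_take map_tnth_enum.
have cE : c = word_prod s u.
  by rewrite hc -def_u /word_prod big_map.
have Tmem k (t : k.-tuple W) : (forall i, T (tnth t i)) ->
    forall x, x \in tval t -> reflection s x.
  by move=> Tt x /tnthP[i ->]; rewrite /reflection -TE.
have invol k (t : k.-tuple W) : (forall i, T (tnth t i)) -> involutive_tuple t.
  move=> Tt j; have [ltj|lej] := ltnP j k; last first.
    by rewrite nth_default ?size_tuple // mulg1.
  by apply/(reflection_invol sys)/(Tmem _ _ Tt)/mem_nth; rewrite size_tuple.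
have to_s k (t : k.-tuple W) : k = n -> (forall i, T (tnth t i)) ->
    c = \prod_(x <- t) x -> exists b : braid_group k, hurwitz b t = take n s :> seq W.
  move=> kn Tt tc.
  have [_ path_tu] := hurwitz_simple sys (Tmem _ _ Tt) uu (etrans (esym tc) cE).
  rewrite -def_u; apply: hurwitz_path_braid (invol _ _ Tt); apply: path_tu.
  by rewrite size_tuple su.
split; last by move=> t; apply: to_s.
have s_fact : factorization T c (in_tuple (take n s)).
  split=> [i|]; last by rewrite hc.
  have /mem_take/tnthP[j ->] := mem_tnth i (in_tuple (take n s)).
  by rewrite TE; apply: reflection_gen.
have sz_s : size (take n s) = n by rewrite -def_u size_map.
have len : refl_length T c = n.
  rewrite /refl_length; case: pselect => [ex_fact|[]]; last first.
    by exists (size (take n s)); apply/asboolP; exists (in_tuple (take n s)).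
  have [k /asboolP[t [Tt tc]] kmin] := ex_minnP ex_fact; apply/eqP.
  rewrite eqn_leq; apply/andP; split.
    rewrite -[X in (_ <= X)%N]sz_s; apply: kmin; apply/asboolP.
    by exists (in_tuple (take n s)).
  have [] := hurwitz_simple sys (Tmem _ _ Tt) uu (etrans tc cE).
  by rewrite size_tuple su.
move=> t v [Tt tc] [Tv vc].
have [b bE] := to_s _ t len Tt (esym tc).
have [b' b'E] := to_s _ v len Tv (esym vc).
exists (b'^-1 * b); have := invol _ _ Tv; have := invol _ _ Tt => tI vI.
rewrite hurwitzM // (_ : hurwitz b t = hurwitz b' v); last first.
  by apply/val_inj; rewrite /= bE b'E.
by rewrite -hurwitzM // mulVg hurwitz1.
Qed.
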